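(* Let $0<\alpha\leq 1$, and let $I$ be a subset of $[0,1]$ such that $\dim_{\mathcal{H}}([0,1]\setminus I)<\alpha$. Let $f\in C^{1,\alpha}([0,1])$ be nonlinear and let $\Lambda$ be a Borel subset of $\mathbb{R}^2$. Suppose that the set $$E:=\bigcup_{(a,b)\in\Lambda}\{(x,y)\in\mathbb{R}^2 \mid y=ax+b\}$$ contains $\{(x,f(x)) : x\in I\}$. Then $\dim_{\mathcal{H}}(E)\geq \alpha+1$.
   Context: $\dim_{\mathcal{H}}$ denotes Hausdorff dimension. $C^{1,\alpha}([0,1])$ is the space of continuously differentiable real-valued functions on $[0,1]$ whose derivative is $\alpha$-H\''older continuous. A function $f$ on $[0,1]$ is linear if $f(x)=kx+c$ for some constants $k,c\in\mathbb{R}$ and all $x$; nonlinear means not linear in this (affine) sense. *)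

(* Defs.v *)
From mathcomp Require Import all_boot all_order all_algebra.
From mathcomp Require Import all_classical all_reals all_analysis.

Set Implicit Arguments.
Unset Strict Implicit.
Unset Printing Implicit Defensive.

Import Order.TTheory GRing.Theory Num.Theory.
Import numFieldNormedType.Exports.

Local Open Scope classical_set_scope.
Local Open Scope ring_scope.
Local Open Scope ereal_scope.

(* The distance is an explicit argument because the library metric on
   [R * R] is the sup metric, whereas the plane is Euclidean here. *)
Section hausdorff.
Context {R : realType} {T : Type} (dist : T -> T -> R).
Implicit Types (A U : set T) (s delta : R).

(* -oo on the empty set *)
Definition diam U : \bar R :=
  ereal_sup [set (dist p.1 p.2)%:E | p in U `*` U].

(* The case distinction gives the empty set weight 0 also when s = 0; a
   singleton has weight 0 `^ 0 = 1 in that case, so that the measure below is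
   the counting measure for s = 0. *)
Definition hweight s U : \bar R :=
  if U == set0 then 0 else poweR (diam U) s.

Definition delta_cover delta A : set ((set T)^nat) :=
  [set F | A `<=` \bigcup_i F i /\ forall i, diam (F i) <= delta%:E].

Definition hausdorff_premeasure s delta A : \bar R :=
  ereal_inf [set \sum_(0 <= i <oo) hweight s (F i) | F in delta_cover delta A].

(* supremum = limit as delta -> 0+, by monotonicity in delta *)
Definition hausdorff_measure s A : \bar R :=
  ereal_sup
    [set hausdorff_premeasure s delta A | delta in [set delta | (0 < delta)%R]].

(* The empty set gets dimension 0. *)
Definition hausdorff_dim A : \bar R :=
  ereal_inf [set s%:E | s in [set s | (0 <= s)%R /\ hausdorff_measure s A = 0]].

End hausdorff.

Local Close Scope ereal_scope.

Definition dist_line {R : realType} (x y : R) : R := `|x - y|.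

Definition dist_plane {R : realType} (p q : R * R) : R :=
  Num.sqrt ((p.1 - q.1) ^+ 2 + (p.2 - q.2) ^+ 2).

Definition borel {T : topologicalType} : set (set T) := <<s @open T >>.

(* Only the values of [f] on [0, 1] matter; derivatives at 0 and 1 are
   one-sided. *)
Definition derivative_on01 {R : realType} (f g : R -> R) : Prop :=
  forall x : R, `[0, 1]%classic x ->
    (f y - f x) / (y - x) @[y --> within `[0, 1]%classic x^'] --> g x.

Definition holder_on01 {R : realType} (alpha : R) (g : R -> R) : Prop :=
  exists C : R, forall x y : R, `[0, 1]%classic x -> `[0, 1]%classic y ->
    `|g x - g y| <= C * `|x - y| `^ alpha.

Definition C1holder {R : realType} (alpha : R) (f : R -> R) : Prop :=
  exists g : R -> R,
    [/\ derivative_on01 f g, {within `[0, 1]%classic, continuous g}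
      & holder_on01 alpha g].

Definition linear_on01 {R : realType} (f : R -> R) : Prop :=
  exists k c : R, forall x : R, `[0, 1]%classic x -> f x = k * x + c.

Definition line {R : realType} (ab : R * R) : set (R * R) :=
  [set p | p.2 = ab.1 * p.1 + ab.2].

(* Main.v *)
Require Import Defs.
From mathcomp Require Import all_boot all_order all_algebra.
From mathcomp Require Import all_classical all_reals all_analysis.
From mathcomp Require Import zify ring lra.

Set Implicit Arguments.
Unset Strict Implicit.
Unset Printing Implicit Defensive.

Import Order.TTheory GRing.Theory Num.Theory.
Import numFieldNormedType.Exports.

Local Open Scope classical_set_scope.
Local Open Scope ring_scope.

(** Let [g] be the derivative of [f]. It is not constant, so by continuity its
values fill an interval [[c, c + w[]. For [y] in this interval pick a point [phi y]
of [[0, 1]] with [g (phi y) = y]. Since [g] is Hoelder of exponent [alpha] and the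
complement of [I] has dimension less than [alpha], its image under [g] has length
zero ([holder_image_null]); so for almost every [y] some line [(a y, b y)] of
[Lambda] passes through the point of the graph above [phi y]. The label [y] thus
transports Lebesgue measure to [Lambda].

This measure satisfies a Frostman condition of exponent [alpha], that is, lines at
distance [r] have labels at distance of the order of [r `^ alpha], after restriction
to a subset of labels of positive outer measure ([exists_separated_piece]). If the
line is tangent to the graph then its slope is [y] itself. If it crosses the graph
at an angle bounded below then it determines [phi y] in a Lipschitz way, hence [y =
g (phi y)] in a Hoelder way.

It remains to see that the union of a family of lines with this property has
dimension at least [1 + alpha] ([kakeya_bound]). Suppose that for some [t < 1 +
alpha] it has covers with arbitrarily small sums of [t]-th powers of the diameters.
Rounding the diameters to powers of two, a pigeonhole argument on the scales, first
for each line and then for the labels, yields a scale [2 ^- k] such that a large set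
of lines is caught along a large part of its length by the [N] covering sets of that
scale. Select about [2 ^ k `^ alpha] of these lines with separated labels. Two lines
of slopes [a] and [a'] can meet the same sets of scale [2 ^- k] only over a segment
of length about [2 ^- k / `|a - a'|], so Cauchy-Schwarz ([incidence_bound]) bounds
[N] from below by about [2 ^ k `^ (1 + alpha)], which contradicts the smallness of
[N * 2 ^ k `^ (- t)].

Outer measure is countably subadditive on arbitrary sets and only this is used, so
the choices of points and lines need not be measurable. *)

(** * Lebesgue outer measure *)

Section outer.
Context {R : realType}.
Local Open Scope ereal_scope.

(** Lebesgue outer measure, defined on every subset of the line: the sets measured
below are obtained by choosing points and lines arbitrarily, so they need not be
measurable. The domain is [ocitv_type R], a copy of [R], because that is where the
length of half-open intervals lives. *)
Definition outer_length : {outer_measure set (ocitv_type R) -> \bar R} :=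
  mu_ext (wlength (@idfun R)).

Lemma outer_length_itv (u l : R) : (0 <= l)%R ->
  outer_length [set x | (u <= x < u + l)%R] = l%:E.
Proof.
move=> l0; have -> : [set x | (u <= x < u + l)%R] = [set` `[u, (u + l)%R[].
  by apply/seteqP; split => x /=; rewrite in_itv.
have /= := lebesgue_measure_itv `[u, (u + l)%R[.
rewrite lte_fin ltrDl -EFinD addrAC subrr add0r => H.
rewrite (_ : outer_length _ = lebesgue_measure `[u, (u + l)%R[%classic) // H.
by case: ltP => // l0'; congr EFin; apply/eqP; rewrite eq_le l0 l0'.
Qed.

Lemma outer_length_sigma (A : set R) (F : nat -> set R) :
  A `<=` \bigcup_k F k -> outer_length A <= \sum_(0 <= k <oo) outer_length (F k).
Proof.
move=> AF; apply: le_trans (outer_measure_sigma_subadditive outer_length F).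
exact: le_outer_measure.
Qed.

Lemma outer_length_itvs (T : finType) (B : {pred T}) (u : T -> R) (l : R)
    (A : set R) :
  (0 <= l)%R ->
  (forall x, A x -> exists2 i, i \in B & (u i <= x < u i + l)%R) ->
  outer_length A <= (#|B|%:R * l)%:E.
Proof.
move=> l0 cov.
have {cov} cov x : A x -> exists2 i, i \in enum B & (u i <= x < u i + l)%R.
  by move=> /cov[i iB ui]; exists i; rewrite ?mem_enum.
rewrite cardE; elim: (enum B) A cov => [|i s IHs] A cov.
  rewrite (_ : A = set0) ?outer_measure0 ?mul0r//.
  by rewrite -subset0 => x /cov[].
pose C := [set x | (u i <= x < u i + l)%R].
apply: (@le_trans _ _ (outer_length (C `|` (A `\` C)))).
  by apply: le_outer_measure => x Ax; have [?|?] := pselect (C x); [left|right].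
apply: le_trans (outer_measureU2 _ _ _) _.
rewrite /= -natr1 mulrDl mul1r addrC EFinD leeD// ?outer_length_itv//.
apply: IHs => x [/cov[j]]; rewrite inE => /orP[/eqP ->|js] //.
by exists j.
Qed.

(** Quantitative pigeonhole: the weights [(1 - theta) / 2 * theta ^+ k] add up to [1
/ 2] only, so countably many sets that are all smaller than their share cannot cover
[A]. The loss [theta ^+ k] is harmless when [k] is the index of the dyadic scale [2
^- k] and [theta] is close to [1], since every gain below is a fixed power of the
scale. *)
Lemma outer_length_pigeonhole (theta V : R) (A : set R) (F : nat -> set R) :
  (0 < theta < 1)%R -> (0 < V)%R -> V%:E <= outer_length A ->
  A `<=` \bigcup_k F k ->
  exists k, ((1 - theta) / 2 * theta ^+ k * V)%:E <= outer_length (F k).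
Proof.
move=> /andP[t0 t1] V0 VA AF; apply: contrapT => /forallNP small.
pose w := geometric ((1 - theta) / 2 * V)%R theta.
have {}small k : outer_length (F k) <= (w k)%:E.
  rewrite /w /geometric /= mulrAC; apply/ltW; rewrite ltNge; exact/negP.
have := le_trans VA (outer_length_sigma AF).
apply/negP; rewrite -ltNge.
apply: (@le_lt_trans _ _ (\sum_(0 <= k <oo) (w k)%:E)).
  by apply: lee_nneseries => // k _ _; exact: outer_measure_ge0.
have -> : \sum_(0 <= k <oo) (w k)%:E = (V / 2)%:E.
  apply/cvg_lim => //.
  have -> : (V / 2 = (1 - theta) / 2 * V * (1 - theta)^-1)%R.
    by field; rewrite gt_eqF // subr_gt0.
  have : (`|theta| < 1)%R by rewrite gtr0_norm.
  move=> /(@cvg_geometric_series R ((1 - theta) / 2 * V)%R) H.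
  apply: cvg_EFin; first by apply: nearW => n; rewrite sumEFin.
  rewrite (_ : fine \o _ = series w) //.
  by apply/funext => n /=; rewrite sumEFin.
by rewrite lte_fin; lra.
Qed.
Lemma outer_length_piece (V : R) (A : set R) (F : nat -> set R) :
  (0 < V)%R -> V%:E <= outer_length A -> A `<=` \bigcup_k F k ->
  exists k, exists2 W : R, (0 < W)%R & W%:E <= outer_length (F k).
Proof.
move=> V0 VA AF.
have half : (0 < (2^-1 : R) < 1)%R by apply/andP; split; lra.
have [k hk] := outer_length_pigeonhole half V0 VA AF; exists k.
by eexists; last exact: hk; rewrite !mulr_gt0 ?exprn_gt0 //; lra.
Qed.

End outer.

(** * Counting lemmas *)

Lemma sqr_sum_le (C : finType) (B : {set C}) (n : C -> nat) :
  ((\sum_(c in B) n c) ^ 2 <= #|B| * \sum_(c in B) n c ^ 2)%N.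
Proof.
rewrite -(leq_pmul2l (isT : 0 < 2)%N) expnS expn1 big_distrlr /= big_distrr /=.
apply: (@leq_trans (\sum_(c in B) \sum_(d in B) (n c ^ 2 + n d ^ 2))).
  apply: leq_sum => c _; rewrite big_distrr /=; apply: leq_sum => d _.
  by have := nat_Cauchy (n c) (n d); case.
under eq_bigr do rewrite big_split /= sum_nat_const.
by rewrite big_split /= -big_distrr /= sum_nat_const addnn -mul2n leqnn.
Qed.

(** Cauchy-Schwarz in counting form, applied to the sizes of the fibres of [kappa].
*)
Lemma card_sqr_le_collisions (S C : finType) (A : {set S}) (B : {set C})
    (kappa : S -> C) : {in A, forall s, kappa s \in B} ->
  (#|A| ^ 2 <= #|B| * #|[set st : S * S |
    [&& st.1 \in A, st.2 \in A & kappa st.1 == kappa st.2]]%SET|)%N.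
Proof.
move=> AB; pose n c := #|[set s in A | kappa s == c]%SET|.
have -> : #|A| = (\sum_(c in B) n c)%N.
  rewrite -sum1_card (partition_big kappa (fun c => c \in B)) /=; last first.
    by move=> s /AB.
  apply: eq_bigr => c _; rewrite /n -sum1_card.
  by apply: eq_bigl => s; rewrite inE.
apply: leq_trans (sqr_sum_le _ _) _; rewrite leq_mul2l; apply/orP; right.
rewrite -sum1_card (partition_big (fun st => kappa st.1) (mem B)) /=; last first.
  by move=> st; rewrite inE => /and3P[/AB].
apply: leq_sum => c _; rewrite /n expnS expn1 -cardsX -sum1_card.
apply: eq_leq; apply: eq_bigl => -[s t]; rewrite !inE /=.
case: (s \in A); case: (t \in A); rewrite ?andbF //=.
by case: (kappa s =P c) => [<-|_]; rewrite ?andbT ?andbF //= eq_sym.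
Qed.

Lemma card_le_spread (N : nat) (X : {set 'I_N}) : X != finset.set0 ->
  exists p q : 'I_N, [/\ p \in X, q \in X, (p <= q)%N & (#|X| <= (q - p).+1)%N].
Proof.
case/set0Pn => x0 x0X.
have [p pX pmin] := @arg_minnP _ x0 (mem X) (@nat_of_ord N) x0X.
have [q qX qmax] := @arg_maxnP _ x0 (mem X) (@nat_of_ord N) x0X.
exists p, q; split => //; first exact: pmin.
pose f (x : 'I_N) : 'I_(q - p).+1 := inord (x - p).
rewrite -[leqRHS]card_ord -(card_in_imset (f := f)) ?max_card //.
move=> x y xX yX /(congr1 val); have := pmin _ xX; have := pmin _ yX.
have := qmax _ xX; have := qmax _ yX => /= hq hq' hp hp'.
rewrite /f /= !inordK ?ltnS ?leq_sub2r // => h; apply: val_inj => /=.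
by rewrite -(subnK hp) -(subnK hp') h.
Qed.

Section harmonic.
Context {R : realType}.

Lemma harmonic_pow2_le (k : nat) :
  \sum_(0 <= n < 2 ^ k) (n.+1%:R^-1 : R) <= k.+1%:R.
Proof.
elim: k => [|k IHk]; first by rewrite expn0 big_nat1 invr1.
rewrite (@big_cat_nat _ _ _ (2 ^ k)%N 0 (2 ^ k.+1)%N) ?leq_exp2l //= -[leRHS]natr1.
apply: lerD => //.
apply: (@le_trans _ _ (\sum_(2 ^ k <= n < 2 ^ k.+1) ((2 ^ k)%:R^-1 : R))).
  rewrite !big_nat; apply: ler_sum => n /andP[kn _].
  by rewrite lef_pV2 ?posrE ?ltr0n ?expn_gt0 // ler_nat ltnW.
rewrite sumr_const_nat expnS mul2n -addnn addnK -[leLHS]mulr_natr mulVf ?lexx //.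
Qed.

(** The sum over all cells of one over the distance to a given cell is only
logarithmic in the number of cells. *)
Lemma sum_inv_dist_le (k l : nat) : (l < 2 ^ k)%N ->
  \sum_(j < 2 ^ k) (1 + `|l%:R - j%:R|)^-1 <= 2 * k.+1%:R :> R.
Proof.
move=> lk; rewrite -(big_mkord xpredT (fun j => (1 + `|l%:R - j%:R|)^-1)).
have le_harm n : (n <= 2 ^ k)%N ->
    \sum_(0 <= i < n) (i.+1%:R^-1 : R) <= k.+1%:R.
  move=> nk; apply: le_trans (harmonic_pow2_le k).
  by rewrite [leRHS](@big_cat_nat _ _ _ n 0 (2 ^ k)%N) //= lerDl sumr_ge0.
rewrite (@big_cat_nat _ _ _ l.+1 0 (2 ^ k)%N) //= mulrDl mul1r; apply: lerD.
  rewrite big_nat_rev /= add0n.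
  apply: le_trans (le_harm _ lk); rewrite !big_nat; apply: ler_sum => i /andP[_ il].
  rewrite subSS natrB; last by rewrite -ltnS.
  by rewrite opprB addrCA subrr addr0 normr_nat -natr1 addrC.
rewrite -{1}(add0n l.+1) big_addn.
have le2 : (2 ^ k - l.+1 <= 2 ^ k)%N by rewrite leq_subr.
apply: le_trans (le_harm _ le2); rewrite !big_nat; apply: ler_sum => i _.
rewrite lef_pV2 ?posrE ?ltr0n ?ltr_pwDl // distrC natrD -!natr1.
by apply: le_trans (lerD (lexx 1) (ler_norm _)); lra.
Qed.
End harmonic.

Section incidences.
Context {R : realType}.

(** The counting form of the [L^2] argument for thin tubes. The index [l] stands for
a line, [B l] for the columns in which it is caught, and [kappa l p] for the
covering set that catches line [l] in column [p]. Having many incidences forces many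
coincidences [kappa l p = kappa l' p], whereas two lines with labels at distance [n]
have at most [D / (1 + n)] of them; so there must be many codes. *)
Lemma incidence_bound (k : nat) (J : {set 'I_(2 ^ k)})
    (B : 'I_(2 ^ k) -> {set 'I_(2 ^ k)}) (C : finType) (codes : {set C})
    (kappa : 'I_(2 ^ k) -> 'I_(2 ^ k) -> C) (t D : R) :
  0 <= t -> 0 <= D ->
  {in J, forall l, {in B l, forall p, kappa l p \in codes}} ->
  {in J &, forall l l', {in B l & B l', forall p p',
    kappa l p = kappa l' p' -> p = p'}} ->
  {in J, forall l, t <= #|B l|%:R} ->
  {in J &, forall l l',
    #|[set p in B l :&: B l' | kappa l p == kappa l' p]%SET|%:R
      * (1 + `|l%:R - l'%:R|) <= D} ->
  #|J|%:R * t ^+ 2 <= #|codes|%:R * D * (2 * k.+1%:R).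
Proof.
move=> t0 D0 Bcodes same_col Bt coll.
pose A := [set s : 'I_(2 ^ k) * 'I_(2 ^ k) | (s.1 \in J) && (s.2 \in B s.1)]%SET.
pose X l l' := [set p in B l :&: B l' | kappa l p == kappa l' p]%SET.
have AE : #|A| = (\sum_(l in J) #|B l|)%N.
  rewrite -sum1_card (partition_big (fun s => s.1) (fun l => l \in J)) /=; last first.
    by move=> s; rewrite inE => /andP[].
  apply: eq_bigr => l lJ.
  rewrite -(card_in_imset (f := fun p => (l, p))); last by move=> p q _ _ [].
  rewrite -sum1_card; apply: eq_bigl => -[l1 p]; rewrite !inE /=.
  apply/andP/imsetP => [[/andP[_ pB] /eqP l1l]|[q qB [-> ->]]].
    by exists p; rewrite -l1l.
  by rewrite lJ qB eqxx.
have /(card_sqr_le_collisions (kappa := fun s => kappa s.1 s.2)) :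
    {in A, forall s, kappa s.1 s.2 \in codes}.
  by move=> s; rewrite inE => /andP[sJ sB]; exact: Bcodes.
set Z := [set st | _]%SET => cs.
have ZX : (#|Z| <= \sum_(l in J) \sum_(l' in J) #|X l l'|)%N.
  rewrite pair_big_dep /= -sum1_card.
  rewrite (partition_big (fun st => (st.1.1, st.2.1))
    (fun ll : 'I_(2 ^ k) * 'I_(2 ^ k) => (ll.1 \in J) && (ll.2 \in J))) /=; last first.
    by move=> [[l p] [l' p']]; rewrite !inE /= => /and3P[/andP[-> _] /andP[-> _] _].
  apply: leq_sum => -[l l'] /= /andP[lJ l'J].
  pose Zl := [set st in Z | (st.1.1, st.2.1) == (l, l')]%SET.
  apply: (@leq_trans #|Zl|).
    by rewrite -sum1_card; apply: eq_leq; apply: eq_bigl => st; rewrite !inE.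
  have key st : st \in Zl ->
      [/\ st.1.1 = l, st.2.1 = l', st.1.2 \in X l l' & st.1.2 = st.2.2].
    case: st => -[l1 p] [l2 p']; rewrite !inE /= => /andP[/and3P[]].
    move=> /andP[_ pB] /andP[_ p'B] /eqP kk /eqP[l1E l2E]; subst l1 l2.
    have pp := same_col _ _ lJ l'J _ _ pB p'B kk; subst p'.
    by split => //; rewrite pB p'B kk eqxx.
  rewrite -(card_in_imset (f := fun st => st.1.2) (D := mem Zl)); last first.
    move=> [[l1 p1] [l2 p2]] [[l3 p3] [l4 p4]].
    by move=> /key /= [-> -> _ ->] /key /= [-> -> _ ->] ->.
  by apply/subset_leq_card/fintype.subsetP => _ /imsetP[st /key[_ _ stX _] ->].
have [J0|Jpos] := eqVneq #|J| 0%N.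
  by rewrite J0 mul0r !mulr_ge0.
have ZR : #|Z|%:R <= #|J|%:R * (D * (2 * k.+1%:R)) :> R.
  apply: (@le_trans _ _ (\sum_(l in J) \sum_(l' in J) #|X l l'|%:R)).
    apply: (@le_trans _ _ (\sum_(l in J) \sum_(l' in J) #|X l l'|)%N%:R).
      by rewrite ler_nat.
    by rewrite natr_sum; apply: ler_sum => l _; rewrite natr_sum.
  rewrite [leRHS]mulr_natl -sumr_const; apply: ler_sum => l lJ.
  apply: (@le_trans _ _ (\sum_(l' in J) (D * (1 + `|l%:R - l'%:R|)^-1))).
    apply: ler_sum => l' l'J; rewrite ler_pdivlMr ?ltr_pwDl //; exact: coll.
  rewrite -mulr_sumr ler_wpM2l //; apply: le_trans (sum_inv_dist_le (ltn_ord l)).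
  rewrite [leRHS](bigID (mem J)) /= lerDl; apply: sumr_ge0 => i _.
  by rewrite invr_ge0 addr_ge0.
have AR : #|J|%:R * t <= #|A|%:R.
  rewrite AE natr_sum mulr_natl -sumr_const; exact: ler_sum.
have J0 : 0 < #|J|%:R :> R by rewrite ltr0n lt0n.
have {}cs : #|A|%:R ^+ 2 <= #|codes|%:R * #|Z|%:R :> R by rewrite -natrX -natrM ler_nat.
have AR2 : (#|J|%:R * t) ^+ 2 <= #|A|%:R ^+ 2 by rewrite ler_sqr ?nnegrE ?mulr_ge0.
suff : #|J|%:R * (#|J|%:R * t ^+ 2) <= #|J|%:R * (#|codes|%:R * D * (2 * k.+1%:R)).
  by rewrite ler_pM2l.
have -> : #|J|%:R * (#|J|%:R * t ^+ 2) = (#|J|%:R * t) ^+ 2 by ring.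
apply: le_trans AR2 _; apply: le_trans cs _.
have -> : #|J|%:R * (#|codes|%:R * D * (2 * k.+1%:R)) =
  #|codes|%:R * (#|J|%:R * (D * (2 * k.+1%:R))) :> R by ring.
by apply: ler_wpM2l ZR; rewrite ler0n.
Qed.
End incidences.

(** * Hausdorff null sets and dyadic covers *)

Section dyadic.
Context {R : realType}.
Implicit Types (d t theta : R).

Lemma exists_expr_lt theta e : 0 < theta < 1 -> 0 < e ->
  exists k, theta ^+ k < e.
Proof.
move=> /andP[t0 t1] e0; have : `|theta| < 1 by rewrite gtr0_norm.
move=> /(@cvg_geometric R 1)/cvgr0_norm_lt/(_ _ e0)[k _ /(_ k)] /=.
rewrite leqnn => /(_ isT); rewrite mul1r ger0_norm ?exprn_ge0 ?ltW // => h.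
by exists k.
Qed.

Lemma exists_dyadic_scale d : 0 < d <= 1 ->
  exists k, 2^-1 ^+ k.+1 < d <= 2^-1 ^+ k.
Proof.
move=> /andP[d0 d1].
have ex : exists k, 2^-1 ^+ k.+1 < d.
  have half : 0 < (2^-1 : R) < 1 by apply/andP; split; lra.
  have [k hk] := exists_expr_lt half d0; exists k; apply: le_lt_trans hk.
  by rewrite exprS ler_piMl ?exprn_ge0 //; lra.
exists (ex_minn ex); case: ex_minnP => k -> kmin /=.
case: k kmin => [|k] kmin; first by rewrite expr0.
by rewrite leNgt; apply/negP => /kmin; rewrite ltnn.
Qed.

(** With this identity the real powers of a dyadic scale [2 ^- k] become integer
powers of a fixed base, so that the estimates below are polynomial. *)
Lemma dyadic_powR t (k : nat) : (2^-1 ^+ k) `^ t = (2 `^ (- t)) ^+ k.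
Proof.
elim: k => [|k IHk]; first by rewrite !expr0 powR1.
by rewrite !exprS powRM ?invr_ge0 ?exprn_ge0 // IHk -powR_inv1 // -powRrM mulN1r.
Qed.

Lemma powR2N_gt0 t : 0 < 2 `^ (- t) :> R.
Proof. by rewrite powR_gt0. Qed.

Lemma powR2N_lt1 t : 0 < t -> 2 `^ (- t) < 1 :> R.
Proof.
move=> t0; rewrite powRN invf_lt1 ?powR_gt0 //.
by have := gt0_ltr_powR t0; move=> /(_ 1 2); rewrite powR1 !nnegrE; apply; lra.
Qed.

End dyadic.

Section null_covers.
Context {R : realType} {T : Type} (dist : T -> T -> R).

(** Rounding the diameter of a covering set up to a dyadic number costs a constant
factor. The error [e] is there for the sets of diameter zero, which have no such
scale and are given a tiny one. *)
Lemma dyadic_cover_set s t e (U : set T) : (forall p q, 0 <= dist p q) ->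
  0 <= s -> s <= t -> 0 < t -> 0 < e ->
  (diam dist U <= 1%:E)%E ->
  exists k : nat, exists w : R,
    [/\ forall p q, U p -> U q -> dist p q <= 2^-1 ^+ k,
        (0 <= w), (w%:E <= hweight dist s U)%E
      & (2 `^ (- t)) ^+ k <= w / 2 `^ (- t) + e].
Proof.
move=> dist_ge0 s0 st t0 e0 U1; pose sg : R := 2 `^ (- t).
have sg0 : 0 < sg by exact: powR2N_gt0.
have [k0 hk0] : exists k, sg ^+ k < e.
  by apply: exists_expr_lt => //; rewrite sg0 powR2N_lt1.
have hw0 : (0 <= hweight dist s U)%E.
  by rewrite /hweight; case: ifP => // _; exact: poweR_ge0.
have [U0|/set0P[p0 Up0]] := eqVneq U set0.
  exists k0, 0; split => //; first by rewrite U0.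
  by rewrite mul0r add0r ltW.
have ub p q : U p -> U q -> ((dist p q)%:E <= diam dist U)%E.
  by move=> Up Uq; apply: ereal_sup_ubound; exists (p, q).
have d0 : (0 <= diam dist U)%E.
  by apply: le_trans (ub _ _ Up0 Up0); rewrite lee_fin.
have [d dE] : exists d, diam dist U = d%:E.
  exists (fine (diam dist U)); rewrite fineK // fin_numElt (lt_le_trans _ d0) //.
  by rewrite (le_lt_trans U1) // ltry.
have Un0 : U == set0 = false by apply/negbTE/set0P; exists p0.
rewrite dE in U1 d0 ub; rewrite !lee_fin in U1 d0.
have {}ub p q : U p -> U q -> dist p q <= d by move=> /ub H /H; rewrite lee_fin.
move: d0; rewrite le_eqVlt => /orP[/eqP d0|d0].
  exists k0, 0; split => //.
    by move=> p q Up Uq; apply: le_trans (ub _ _ Up Uq) _; rewrite -d0 exprn_ge0.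
  by rewrite mul0r add0r ltW.
have [k /andP[kd dk]] : exists k, 2^-1 ^+ k.+1 < d <= 2^-1 ^+ k.
  by apply: exists_dyadic_scale; rewrite d0.
exists k, (d `^ s); split; rewrite ?powR_ge0 //.
- by move=> p q Up Uq; exact: le_trans (ub _ _ Up Uq) dk.
- by rewrite /hweight Un0 dE poweR_EFin.
rewrite -[leLHS]addr0 lerD ?(ltW e0) // ler_pdivlMr // -exprSr -/sg.
rewrite -dyadic_powR; apply: (@le_trans _ _ (d `^ t)).
  by apply: ge0_ler_powR; rewrite ?nnegrE ?exprn_ge0 // ltW.
by apply: ger_powR => //; rewrite d0.
Qed.

(** All that is used of Hausdorff measure. The exponent may be raised from [s] to
[t] because the diameters are at most [1]; a positive exponent is what allows
singletons to be enlarged. *)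
Lemma hausdorff_null_dyadic_cover s t e (A : set T) :
  (forall p q, 0 <= dist p q) -> 0 <= s -> s <= t -> 0 < t -> 0 < e ->
  hausdorff_measure dist s A = 0%E ->
  exists F : nat -> set T, exists k : nat -> nat,
    [/\ A `<=` \bigcup_i F i,
        forall i p q, F i p -> F i q -> dist p q <= 2^-1 ^+ k i
      & forall n, \sum_(i < n) (2 `^ (- t)) ^+ k i <= e].
Proof.
move=> dist_ge0 s0 st t0 e0 HA; pose sg : R := 2 `^ (- t).
have sg0 : 0 < sg by exact: powR2N_gt0.
have : (hausdorff_premeasure dist s 1 A < (e / 2 * sg)%:E)%E.
  apply: (@le_lt_trans _ _ 0%E); last by rewrite lte_fin mulr_gt0 // divr_gt0.
  by rewrite -HA; apply: ereal_sup_ubound; exists 1 => //=.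
move=> /ereal_inf_lt[_ [F [AF Fd] <-] Fe].
have e_i i : 0 < e / 2 * 2^-1 ^+ i.+1 by rewrite !mulr_gt0 ?exprn_gt0 ?invr_gt0.
have /choice[k] : forall i, exists k : nat, exists w : R,
    [/\ forall p q, F i p -> F i q -> dist p q <= 2^-1 ^+ k,
        (0 <= w), (w%:E <= hweight dist s (F i))%E
      & sg ^+ k <= w / sg + e / 2 * 2^-1 ^+ i.+1].
  by move=> i; apply: dyadic_cover_set.
move=> /choice[w kw]; exists F, k; split => //.
  by move=> i; have [] := kw i.
move=> n; apply: (@le_trans _ _ (\sum_(i < n) (w i / sg + e / 2 * 2^-1 ^+ i.+1))).
  by apply: ler_sum => i _; have [] := kw i.
rewrite big_split /= -mulr_suml -mulr_sumr [leRHS]splitr; apply: lerD.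
  rewrite ler_pdivrMr // -lee_fin; apply: le_trans (ltW Fe).
  rewrite -sumEFin -(big_mkord xpredT (fun i => (w i)%:E)).
  apply: le_trans (nneseries_lim_ge n _); last first.
    by move=> i _ _; have [_ ? ? _] := kw i; apply: le_trans (_ : (w i)%:E <= _)%E.
  by apply: lee_sum => i _; have [] := kw i.
rewrite ler_piMr ?divr_ge0 ?(ltW e0) //.
suff -> : \sum_(i < n) 2^-1 ^+ i.+1 = 1 - 2^-1 ^+ n :> R by rewrite gerBl exprn_ge0.
elim: n => [|n IHn]; first by rewrite big_ord0 expr0 subrr.
by rewrite big_ord_recr /= IHn exprS; field.
Qed.

End null_covers.

(** * Unions of separated lines *)

Section columns.
Context {R : realType}.

Lemma cell_exists (N : nat) (c l x : R) : 0 < l -> 1 <= N%:R * l ->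
  c <= x < c + 1 -> exists p : 'I_N, c + p%:R * l <= x < c + p%:R * l + l.
Proof.
move=> l0 Nl /andP[cx xc]; have xl : 0 <= (x - c) / l by rewrite divr_ge0 ?subr_ge0 // ltW.
have /andP[h1 h2] := truncn_itv xl.
rewrite ler_pdivlMr // in h1; rewrite ltr_pdivrMr // -natr1 mulrDl mul1r in h2.
have pN : (Num.trunc ((x - c) / l)%R < N)%N.
  rewrite -(ltr_nat R) -(ltr_pM2r l0); apply: le_lt_trans h1 _; lra.
by exists (Ordinal pN) => /=; apply/andP; split; lra.
Qed.

(** Two lines whose slopes differ by [da] stay within [D * 2 ^- k] of each other
only over an interval of length [2 * D * 2 ^- k / `|da|]. *)
Lemma card_close_columns (k : nat) (X : {set 'I_(2 ^ k)}) (da db D : R) :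
  {in X, forall p : 'I_(2 ^ k), `|da * (p%:R * 2^-1 ^+ k) + db| <= D * 2^-1 ^+ k} ->
  0 <= D -> #|X|%:R * `|da| <= 2 * D + `|da|.
Proof.
move=> close D0; have [->|X0] := eqVneq X finset.set0.
  by rewrite cards0 mul0r addr_ge0 // mulr_ge0.
have [p [q [pX qX pq Xpq]]] := card_le_spread X0.
apply: (@le_trans _ _ ((q - p).+1%:R * `|da|)).
  by rewrite ler_wpM2r // ler_nat.
rewrite -natr1 mulrDl mul1r lerD2r natrB //.
have d0 : 0 < 2^-1 ^+ k :> R by rewrite exprn_gt0.
rewrite -(ler_pM2r d0); have := close _ pX; have := close _ qX => hq hp.
have q0 : (0 : R) <= q%:R - p%:R by rewrite subr_ge0 ler_nat.
have := ler_normB (da * (q%:R * 2^-1 ^+ k) + db) (da * (p%:R * 2^-1 ^+ k) + db).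
have -> : (da * (q%:R * 2^-1 ^+ k) + db) - (da * (p%:R * 2^-1 ^+ k) + db)
  = (q%:R - p%:R) * da * 2^-1 ^+ k by ring.
rewrite !normrM (ger0_norm q0) (gtr0_norm d0); lra.
Qed.

(** Here [2 ^- kf i] is the dyadic scale assigned to the covering set [F i]. *)
Definition meets_column (F : nat -> set (R * R)) (kf : nat -> nat) (a b : R)
    (k p i : nat) :=
  kf i = k /\ exists2 x, p%:R * 2^-1 ^+ k <= x < p%:R * 2^-1 ^+ k + 2^-1 ^+ k
    & F i (x, a * x + b).

Definition hit_columns (F : nat -> set (R * R)) (kf : nat -> nat) (a b : R)
    (k : nat) : {set 'I_(2 ^ k)} :=
  [set p : 'I_(2 ^ k) | `[< exists i, meets_column F kf a b k p i >]]%SET.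

Lemma pow2_half (k : nat) : (2 ^ k)%:R * 2^-1 ^+ k = 1 :> R.
Proof. by rewrite natrX -exprMn divff ?expr1n. Qed.

(** A covered segment has a scale at which the sets of that scale alone catch a
sizeable part of it. *)
Lemma many_hit_columns (theta : R) (F : nat -> set (R * R)) (kf : nat -> nat)
    (a b : R) :
  0 < theta < 1 -> (forall x, 0 <= x < 1 -> exists i, F i (x, a * x + b)) ->
  exists k,
    (1 - theta) / 2 * theta ^+ k * (2 ^ k)%:R <= #|hit_columns F kf a b k|%:R.
Proof.
move=> t01 cov; pose A := [set x : R | 0 <= x < 0 + 1].
pose E k := [set x : R | 0 <= x < 1 /\ exists2 i, kf i = k & F i (x, a * x + b)].
have A1 : (1%:E <= outer_length A)%E by rewrite outer_length_itv.
have AE : A `<=` \bigcup_k E k.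
  move=> x; rewrite /A /= add0r => x01; have [i Fi] := cov _ x01.
  by exists (kf i) => //; split => //; exists i.
have [k] := outer_length_pigeonhole t01 ltr01 A1 AE; rewrite mulr1 => hk.
exists k; have d0 : 0 < 2^-1 ^+ k :> R by rewrite exprn_gt0.
rewrite -(ler_pM2r d0) -[leLHS]mulrA pow2_half mulr1 -lee_fin; apply: le_trans hk _.
apply: (@outer_length_itvs _ _ _ (fun p : 'I_(2 ^ k) => p%:R * 2^-1 ^+ k)).
  exact: ltW.
move=> x [x01 [i ki Fi]].
have [p hp] : exists p : 'I_(2 ^ k),
    0 + p%:R * 2^-1 ^+ k <= x < 0 + p%:R * 2^-1 ^+ k + 2^-1 ^+ k.
  by apply: cell_exists; rewrite ?pow2_half ?add0r.
rewrite !add0r in hp.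
by exists p => //; rewrite inE; apply/asboolP; exists i; split => //; exists x.
Qed.

(** Transversality against separation. If the lines share a column at all, then
there the hypothesis on [n] applies with [z] of the order of [1 + `|da| * 2 ^ k],
whereas the number of shared columns is at most of the order of [Num.min (2 ^ k)
(`|da|^-1)]; the product is of the order of [2 ^ k]. *)
Lemma collision_bound (k : nat) (X : {set 'I_(2 ^ k)}) (da db D m K n : R) :
  1 <= D -> 0 <= K -> `|da| <= 2 * m ->
  {in X, forall p : 'I_(2 ^ k), `|da * (p%:R * 2^-1 ^+ k) + db| <= D * 2^-1 ^+ k} ->
  (forall x z, 0 <= x <= 1 -> 1 <= z ->
     `|da| + `|da * x + db| <= z * 2^-1 ^+ k -> n <= 1 + K * z) ->
  #|X|%:R * (1 + n) <= (2 + K * D + K * (2 * D + 2 * m)) * (2 ^ k)%:R.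
Proof.
move=> D1 K0 dam close sep; have [X0|/set0Pn[p pX]] := eqVneq X finset.set0.
  rewrite X0 cards0 mul0r !mulr_ge0 //.
  by rewrite !addr_ge0 ?mulr_ge0 // ?addr_ge0 //; have := normr_ge0 da; lra.
have D0 : 0 <= D by lra.
have count := card_close_columns close D0.
have d0 : 0 < 2^-1 ^+ k :> R by rewrite exprn_gt0.
have X2 : #|X|%:R <= (2 ^ k)%:R :> R.
  by rewrite ler_nat -[leqRHS]card_ord max_card.
have nK : n <= 1 + K * (D + `|da| * (2 ^ k)%:R).
  apply: (sep (p%:R * 2^-1 ^+ k)).
  - rewrite mulr_ge0 ?(ltW d0) //= -[leRHS](pow2_half k) ler_wpM2r ?(ltW d0) //.
    by rewrite ler_nat ltnW.
  - by rewrite ler_wpDr // mulr_ge0.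
  by rewrite mulrDl -mulrA pow2_half mulr1 addrC lerD2r close.
apply: (@le_trans _ _ (#|X|%:R * (2 + K * D) + K * (#|X|%:R * `|da|) * (2 ^ k)%:R)).
  have -> : #|X|%:R * (2 + K * D) + K * (#|X|%:R * `|da|) * (2 ^ k)%:R =
    #|X|%:R * (1 + (1 + K * (D + `|da| * (2 ^ k)%:R))) by ring.
  by rewrite ler_wpM2l // lerD2l.
rewrite mulrDl; apply: lerD.
  by rewrite mulrC ler_wpM2l // addr_ge0 // mulr_ge0.
rewrite ler_wpM2r // ler_wpM2l //; apply: le_trans count _; lra.
Qed.

Lemma geometric_harmonic_le (theta : R) (k : nat) : 0 < theta < 1 ->
  k.+1%:R * theta ^+ k * (1 - theta) <= 1.
Proof.
move=> /andP[t0 t1]; suff : k.+1%:R * theta ^+ k * (1 - theta) <= 1 - theta ^+ k.+1.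
  by move=> /le_trans; apply; rewrite gerBl exprn_ge0 // ltW.
elim: k => [|k IHk]; first by rewrite expr0 expr1 !mul1r.
have := ler_wpM2l (ltW t0) IHk.
have : theta ^+ k.+1 <= 1 by rewrite exprn_ile1 // ltW.
rewrite -(natr1 k.+1) ![_ ^+ k.+2]exprS ![theta ^+ k.+1]exprS.
have : 0 <= theta ^+ k by rewrite exprn_ge0 // ltW.
move: (theta ^+ k) (k.+1%:R : R) => u v u0 h1 h2.
have : theta * u * (1 - theta) <= 1 - theta by rewrite ler_piMl // ; lra.
by move: h2; nra.
Qed.

(** With [beta = 2 `^ (- alpha)] this is the Frostman condition of exponent [alpha] on
the set of lines, stated at dyadic scales: a line known up to [z * 2 ^- k] has its
label known up to the order of the [alpha]-th power of this. Lines are compared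
through their slopes and their heights above an arbitrary point [x] of [[0, 1]],
since this is how two lines meeting a common small set are known to be close. *)
Definition separated_lines (beta K : R) (a b : R -> R) (Y : set R) :=
  forall (y y' x z : R) k, Y y -> Y y' -> 0 <= x <= 1 -> 1 <= z ->
    `|a y - a y'| + `|(a y - a y') * x + (b y - b y')| <= z * 2^-1 ^+ k ->
    `|y - y'| <= K * z * beta ^+ k.

End columns.

Section kakeya.
Context {R : realType}.

(** A family of lines with the Frostman property, labelled by a set [Y] of positive
length, cannot be covered by few sets. With [sigma = 2 `^ (- t)] and [beta = 2 `^ (-
alpha)], the hypothesis [beta = 2 * sigma * theta ^+ 4] with [theta < 1] says that
[t < 1 + alpha]: four powers of [theta] are spent below, one for selecting the
scale, two for the part of each line caught at that scale, and one for the logarithm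
of [sum_inv_dist_le]. *)
Lemma kakeya_bound (Y : set R) (a b : R -> R) (c m K V beta sigma theta e : R)
    (F : nat -> set (R * R)) (kf : nat -> nat) :
  0 < theta < 1 -> 0 < sigma -> 2^-1 <= beta -> beta = 2 * sigma * theta ^+ 4 ->
  0 <= m -> 0 <= K -> 0 < V -> (V%:E <= outer_length Y)%E ->
  (forall y, Y y -> c <= y < c + 1) -> (forall y, Y y -> `|a y| <= m) ->
  separated_lines beta K a b Y ->
  (forall y x : R, Y y -> 0 <= x < 1 -> exists i, F i (x, a y * x + b y)) ->
  (forall i p q, F i p -> F i q ->
    `|p.1 - q.1| <= 2^-1 ^+ kf i /\ `|p.2 - q.2| <= 2^-1 ^+ kf i) ->
  (forall n, \sum_(i < n) sigma ^+ kf i <= e) ->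
  V * ((1 - theta) / 2) ^+ 3 * (1 - theta)
    <= 4 * e * (2 + K * (2 * m + 1) + K * (2 * (2 * m + 1) + 2 * m)).
Proof.
move=> t01 sigma0 beta2 betaE m0 K0 V0 VY Yc am sep cov Fd Fe.
have /andP[t0 t1] := t01.
pose c0 : R := (1 - theta) / 2.
have c00 : 0 < c0 by rewrite divr_gt0 // subr_gt0.
pose Yk k := [set y | Y y /\
  c0 * theta ^+ k * (2 ^ k)%:R <= #|hit_columns F kf (a y) (b y) k|%:R].
have YYk : Y `<=` \bigcup_k Yk k.
  move=> y Yy.
  have [k hk] := many_hit_columns kf t01 (fun x => @cov y x Yy).
  by exists k.
have [k hk] := outer_length_pigeonhole t01 V0 VY YYk.
have beta0 : 0 < beta by apply: lt_le_trans beta2.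
have bk0 : 0 < beta ^+ k by rewrite exprn_gt0.
have d0 : 0 < 2^-1 ^+ k :> R by rewrite exprn_gt0.
(* [2 ^ k] cells of length [beta ^+ k] are more than enough to cover [[c, c + 1]]. *)
pose cell (l : 'I_(2 ^ k)) (y : R) :=
  c + l%:R * beta ^+ k <= y < c + l%:R * beta ^+ k + beta ^+ k.
pose J := [set l : 'I_(2 ^ k) | `[< exists2 y, Yk k y & cell l y >]]%SET.
have cJ : c0 * theta ^+ k * V <= #|J|%:R * beta ^+ k.
  rewrite -lee_fin; apply: le_trans hk _.
  apply: (@outer_length_itvs _ _ _ (fun l : 'I_(2 ^ k) => c + l%:R * beta ^+ k)).
    exact: ltW.
  move=> y Yky; have [l hl] : exists l, cell l y.
    apply: cell_exists => //; last by apply: Yc; case: Yky.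
    by rewrite -[leLHS](pow2_half k) ler_wpM2l // lerXn2r ?nnegrE // ltW.
  by exists l => //; rewrite inE; apply/asboolP; exists y.
(* One line per occupied cell. *)
have [y_ hy] : exists y_ : 'I_(2 ^ k) -> R,
    forall l, l \in J -> Yk k (y_ l) /\ cell l (y_ l).
  have /choice[y_ hy] : forall l : 'I_(2 ^ k),
      exists y, l \in J -> Yk k y /\ cell l y.
    move=> l; have [lJ|lJ] := boolP (l \in J); last by exists 0.
    by move: (lJ); rewrite inE => /asboolP[y ? ?]; exists y.
  by exists y_.
pose B l := hit_columns F kf (a (y_ l)) (b (y_ l)) k.
(* Charging each incidence to a single covering set makes overlaps of the cover harmless. *)
have [idx hidx] : exists idx : 'I_(2 ^ k) -> 'I_(2 ^ k) -> nat,
    forall l p, p \in B l ->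
    meets_column F kf (a (y_ l)) (b (y_ l)) k p (idx l p).
  have /choice[idx hidx] : forall lp : 'I_(2 ^ k) * 'I_(2 ^ k),
      exists i : nat, lp.2 \in B lp.1 ->
    meets_column F kf (a (y_ lp.1)) (b (y_ lp.1)) k lp.2 i.
    move=> [l p] /=; have [pB|pB] := boolP (p \in B l); last by exists 0.
    by move: (pB); rewrite inE => /asboolP[i hi]; exists i.
  by exists (fun l p => idx (l, p)) => l p /(hidx (l, p)).
pose n := (\max_(lp : 'I_(2 ^ k) * 'I_(2 ^ k)) idx lp.1 lp.2).+1.
have idxn l p : (idx l p < n)%N.
  by rewrite ltnS; exact: (leq_bigmax (F := fun lp => idx lp.1 lp.2) (l, p)).
pose N := #|[set i : 'I_n | kf i == k]%SET|.
have Ne : N%:R * sigma ^+ k <= e.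
  apply: le_trans (Fe n); rewrite (bigID (fun i : 'I_n => kf i == k)) /=.
  have -> : \sum_(i < n | kf i == k) sigma ^+ kf i = N%:R * sigma ^+ k.
    rewrite (eq_bigr (fun=> sigma ^+ k)); last by move=> i /eqP ->.
    by rewrite sumr_const mulr_natl; congr (_ *+ _); apply: eq_card => i; rewrite !inE.
  rewrite lerDl.
  by apply: sumr_ge0 => i _; rewrite exprn_ge0 // ltW.
(* A set of diameter at most one column width meets at most two columns, adjacent ones; the parity
   tells them apart. *)
pose kappa l p : 'I_n * bool := (Ordinal (idxn l p), odd p).
pose codes : {set 'I_n * bool} :=
  finset.setX [set i : 'I_n | kf i == k]%SET [set: bool]%SET.
pose D : R := 2 * m + 1.
pose KK : R := 2 + K * D + K * (2 * D + 2 * m).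
have D0 : 0 <= D by rewrite addr_ge0 // mulr_ge0.
have KK0 : 0 <= KK by rewrite !addr_ge0 ?mulr_ge0 // ?addr_ge0 // mulr_ge0.
have inJ l : l \in J -> Y (y_ l) by move=> /hy[[]].
have near_col l l' p p' i :
    meets_column F kf (a (y_ l)) (b (y_ l)) k p i ->
    meets_column F kf (a (y_ l')) (b (y_ l')) k p' i ->
    `|p%:R - p'%:R| < 2 :> R.
  move=> [ki [x hx Fx]] [_ [x' hx' Fx']].
  have [/= + _] := Fd _ _ _ Fx Fx'; rewrite ki => xx'.
  rewrite -(ltr_pM2r d0) -{1}(gtr0_norm d0) -normrM mulrBl ltr_norml.
  by move: xx'; rewrite ler_norml => /andP[? ?]; apply/andP; split; lra.
have same_col : {in J &, forall l l', {in B l & B l', forall p p' : 'I_(2 ^ k),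
    kappa l p = kappa l' p' -> p = p'}}.
  move=> l l' _ _ p p' pB p'B [ii' pp'].
  have := hidx _ _ p'B; rewrite -ii' => hp'.
  have h := near_col _ _ _ _ _ (hidx _ _ pB) hp'; apply: val_inj => /=.
  have : (p < p' + 2)%N /\ (p' < p + 2)%N.
    rewrite -!(ltr_nat R) !natrD; move: h.
    by rewrite ltr_norml => /andP[? ?]; split; lra.
  by move=> [h1 h2]; apply/eqP; move: pp' h1 h2; clear; lia.
have bound : #|J|%:R * (c0 * theta ^+ k * (2 ^ k)%:R) ^+ 2
    <= #|codes|%:R * (KK * (2 ^ k)%:R) * (2 * k.+1%:R).
  apply: (@incidence_bound R k J B _ codes kappa).
  - by rewrite mulr_ge0 // mulr_ge0 ?(ltW c00) // exprn_ge0 // ltW.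
  - by rewrite mulr_ge0.
  - move=> l lJ p pB; rewrite /kappa !inE /= andbT; apply/eqP.
    by have [] := hidx _ _ pB.
  - exact: same_col.
  - by move=> l /hy[[]].
  move=> l l' lJ l'J; pose da := a (y_ l) - a (y_ l').
  pose db := b (y_ l) - b (y_ l').
  have aml := am _ (inJ _ lJ); have aml' := am _ (inJ _ l'J).
  apply: (@collision_bound R k _ da db).
  - by rewrite /D lerDr mulr_ge0.
  - exact: K0.
  - by apply: le_trans (ler_normB _ _) _; lra.
  - move=> p; rewrite finset.in_set => /andP[/finset.setIP[pB p'B] /eqP[ii']].
    have [ki [x hx Fx]] := hidx _ _ pB; have := hidx _ _ p'B.
    rewrite -ii' => -[_ [x' hx' Fx']].
    have [/= _] := Fd _ _ _ Fx Fx'; rewrite ki => LL.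
    have offset u v : `|u| <= m ->
        p%:R * 2^-1 ^+ k <= v < p%:R * 2^-1 ^+ k + 2^-1 ^+ k ->
        `|u * (v - p%:R * 2^-1 ^+ k)| <= m * 2^-1 ^+ k.
      move=> um /andP[v1 v2]; rewrite normrM ler_pM // ger0_norm; lra.
    have := offset _ _ aml' hx'; have := offset _ _ aml hx => o1 o2.
    have -> : da * (p%:R * 2^-1 ^+ k) + db =
        ((a (y_ l) * x + b (y_ l)) - (a (y_ l') * x' + b (y_ l')))
        - a (y_ l) * (x - p%:R * 2^-1 ^+ k)
        + a (y_ l') * (x' - p%:R * 2^-1 ^+ k).
      by rewrite /da /db; ring.
    apply: le_trans (ler_normD _ _) _.
    apply: le_trans (lerD (ler_normB _ _) (lexx _)) _.
    by rewrite /D; lra.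
  move=> x z x01 z1 close.
  have := sep _ _ _ _ _ (inJ _ lJ) (inJ _ l'J) x01 z1 close.
  have [_ /andP[h1 h2]] := hy _ lJ; have [_ /andP[h3 h4]] := hy _ l'J => yy.
  rewrite -(ler_pM2r bk0) -{1}(gtr0_norm bk0) -normrM mulrBl ler_norml.
  by move: yy; rewrite ler_norml => /andP[? ?]; apply/andP; split; lra.
have codesE : #|codes|%:R = 2 * N%:R :> R.
  by rewrite cardsX cardsT card_bool natrM mulrC.
rewrite codesE in bound.
have geo := geometric_harmonic_le k t01.
have betakE : beta ^+ k = (2 ^ k)%:R * sigma ^+ k * (theta ^+ k) ^+ 4.
  by rewrite betaE 2!exprMn natrX -!exprM mulnC.
have s0 : 0 < sigma ^+ k by rewrite exprn_gt0.
have u0 : 0 < theta ^+ k by rewrite exprn_gt0.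
have w0 : 0 < (2 ^ k)%:R :> R by rewrite ltr0n expn_gt0.
rewrite betakE in cJ; rewrite -/c0 -/D -/KK.
(* What remains is elimination of [#|J|] and [N] from [cJ], [bound], [Ne] and [geo]. *)
move: (theta ^+ k) (sigma ^+ k) ((2 ^ k)%:R : R) (k.+1%:R : R) (#|J|%:R : R)
  (N%:R : R) u0 s0 w0 (ler0n R k.+1) cJ bound Ne geo.
move=> u s w k1 j nn u0 s0 w0 k10 cJ bound Ne geo.
have {}bound : j * c0 ^+ 2 * u ^+ 2 * w <= 4 * nn * KK * k1.
  rewrite -(ler_pM2r w0); apply: le_trans (_ : _ <= _) (_ : _ <= _); first last.
  - by apply: le_trans bound _; rewrite le_eqVlt; apply/orP; left; apply/eqP; ring.
  - by rewrite le_eqVlt; apply/orP; left; apply/eqP; ring.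
have {}bound : j * c0 ^+ 2 * u ^+ 2 * w * s <= 4 * e * KK * k1.
  apply: (@le_trans _ _ (4 * nn * KK * k1 * s)); first by rewrite ler_pM2r.
  have -> : 4 * nn * KK * k1 * s = 4 * (nn * s) * (KK * k1) by ring.
  have -> : 4 * e * KK * k1 = 4 * e * (KK * k1) by ring.
  by rewrite ler_wpM2r ?mulr_ge0 // ler_wpM2l.
have {}cJ : c0 * V <= j * w * s * u ^+ 3.
  rewrite -(ler_pM2r u0).
  have -> : j * w * s * u ^+ 3 * u = j * (w * s * u ^+ 4) by ring.
  by rewrite mulrAC.
have Vc : V * c0 ^+ 3 <= 4 * e * KK * k1 * u.
  apply: (@le_trans _ _ (j * c0 ^+ 2 * u ^+ 2 * w * s * u)); last by rewrite ler_pM2r.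
  have -> : V * c0 ^+ 3 = c0 ^+ 2 * (c0 * V) by ring.
  have -> : j * c0 ^+ 2 * u ^+ 2 * w * s * u = c0 ^+ 2 * (j * w * s * u ^+ 3).
    by ring.
  by rewrite ler_wpM2l // exprn_ge0 // ltW.
have e0 : 0 <= e by have := Fe 0%N; rewrite big_ord0.
apply: (@le_trans _ _ (4 * e * KK * k1 * u * (1 - theta))).
  by rewrite ler_wpM2r // subr_ge0 ltW.
have -> : 4 * e * KK * k1 * u * (1 - theta)
  = 4 * e * KK * (k1 * u * (1 - theta)) by ring.
by rewrite ler_piMr // !mulr_ge0.
Qed.
End kakeya.

(** * Functions with Hoelder derivative *)

Section calculus.
Context {R : realType}.
Implicit Types (f g : R -> R).

(** First-order expansion. Multiplying out the difference quotient also covers [y =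
x] and the end points, where the derivative is one-sided. *)
Lemma derivative_on01_approx f g x e :
  derivative_on01 f g -> `[0, 1]%classic x -> 0 < e ->
  exists2 d, 0 < d & forall y, `[0, 1]%classic y -> `|y - x| < d ->
    `|f y - f x - g x * (y - x)| <= e * `|y - x|.
Proof.
move=> fg x01 e0; have /cvgrPdist_le/(_ _ e0) := fg _ x01.
rewrite near_withinE => -[d /= d0 hd]; exists d => // y y01 yx.
have [->|neq] := eqVneq y x; first by rewrite !subrr mulr0 subrr normr0 mulr0.
have := hd y; rewrite /ball /= distrC => /(_ yx neq y01).
have yx0 : y - x != 0 by rewrite subr_eq0.
rewrite -(ler_pM2r (_ : 0 < `|y - x|)) ?normr_gt0 // -normrM.
by rewrite mulrBl divfK // distrC.
Qed.

Lemma derivative_on01_is_derive f g (x : R) : derivative_on01 f g -> x \in `]0, 1[ ->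
  is_derive x 1 f (g x).
Proof.
move=> fg; rewrite in_itv /= => /andP[x0 x1].
have x01 : `[0, 1]%classic x by rewrite /= in_itv /= !ltW.
suff H : h^-1 *: (f (h *: (1 : R^o) + x) - f x) @[h --> 0^'] --> g x.
  by apply: DeriveDef; [apply/cvg_ex; exists (g x) | exact/cvg_lim].
apply/cvgrPdist_le => e e0; have [d d0 hd] := derivative_on01_approx fg x01 e0.
near=> h.
have h0 : h != 0 by near: h; exact: nbhs_dnbhs_neq.
have hd' : `|h| < Num.min d (Num.min x (1 - x)).
  near: h; apply: dnbhs0_lt; rewrite !lt_min d0 x0 subr_gt0 x1 //.
move: hd'; rewrite !lt_min => /and3P[h1 h2 h3].
have := hd (h + x); rewrite /= addrK in_itv /=.
have -> : h *: (1 : R^o) = h by rewrite /GRing.scale /= mulr1.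
have hx : 0 <= h + x <= 1.
  by move: h2 h3; rewrite !ltr_norml => /andP[? ?] /andP[? ?]; apply/andP; split; lra.
move=> /(_ hx h1) H.
rewrite -(ler_pM2r (_ : 0 < `|h|)) ?normr_gt0 // -normrM.
apply: le_trans H; rewrite le_eqVlt; apply/orP; left; apply/eqP.
rewrite -normrN; congr `|_|; rewrite /GRing.scale /=; field.
Unshelve. all: by end_near.
Qed.

Lemma derivative_on01_continuous f g : derivative_on01 f g ->
  {within `[0, 1]%classic, continuous f}.
Proof.
move=> fg; apply/subspace_continuousP => x x01; apply/cvgrPdist_lt => e e0.
have [d d0 hd] := derivative_on01_approx fg x01 ltr01.
pose M := `|g x| + 1; have M0 : 0 < M by rewrite ltr_wpDl.
rewrite near_withinE; exists (Num.min d (e / M)) => /=.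
  by rewrite lt_min d0 divr_gt0.
move=> y; rewrite /ball /= distrC lt_min => /andP[yd ye] y01.
have {}hd := hd _ y01 yd; rewrite ltr_pdivlMr // in ye.
rewrite distrC; apply: le_lt_trans ye.
have -> : f y - f x = (f y - f x - g x * (y - x)) + g x * (y - x) by rewrite subrK.
apply: le_trans (ler_normD _ _) _; rewrite normrM /M; lra.
Qed.

Lemma derivative_on01_cst f g k : derivative_on01 f g ->
  (forall x, `[0, 1]%classic x -> g x = k) -> linear_on01 f.
Proof.
move=> fg gk; exists k, (f 0) => x; rewrite /= in_itv /= => /andP[x0 x1].
move: x0; rewrite le_eqVlt => /orP[/eqP <-|x0]; first by rewrite mulr0 add0r.
have [||z] := @MVT R f g 0 x x0.
- move=> z; rewrite in_itv /= => /andP[z0 zx]; apply: derivative_on01_is_derive fg _.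
  by rewrite in_itv /= z0 (lt_le_trans zx).
- apply: continuous_subspaceW (derivative_on01_continuous fg) => z /=.
  by rewrite !in_itv /= => /andP[-> /le_trans]; apply.
rewrite in_itv /= => /andP[z0 zx]; rewrite subr0 gk; last first.
  by rewrite /= in_itv /= (ltW z0) (le_trans (ltW zx)).
by move=> <-; rewrite subrK.
Qed.

Lemma nonconstant_image_itv g : {within `[0, 1]%classic, continuous g} ->
  ~ (exists k, forall x, `[0, 1]%classic x -> g x = k) ->
  exists c w, 0 < w <= 1 /\
    forall y, c <= y < c + w -> exists2 x, `[0, 1]%classic x & g x = y.
Proof.
move=> gc gnc.
have [u [v [u01 v01 uv]]] : exists u v,
    [/\ `[0, 1]%classic u, `[0, 1]%classic v & g u < g v].
  apply: contrapT => H; apply: gnc; exists (g 0) => x x01.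
  have z01 : `[0, 1]%classic (0 : R) by rewrite /= in_itv /= lexx ler01.
  apply/eqP; rewrite eq_le !leNgt.
  by apply/andP; split; apply/negP => lt; apply: H; [exists 0, x | exists x, 0].
exists (g u), (Num.min 1 (g v - g u)); split.
  by rewrite lt_min ltr01 subr_gt0 uv ge_min lexx.
move=> y /andP[uy yv].
have {}yv : y < g v.
  apply: lt_le_trans yv _; by rewrite -lerBrDl ge_min lexx orbT.
pose p := Num.min u v; pose q := Num.max u v.
have pq : p <= q by rewrite ge_min le_max lexx.
have sub : `[p, q]%classic `<=` `[0, 1]%classic.
  move: u01 v01; rewrite /= !in_itv /= => /andP[u0 u1] /andP[v0 v1] z /=.
  rewrite !in_itv /= => /andP[pz zq]; apply/andP; split.
    by apply: le_trans pz; rewrite le_min u0.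
  by apply: le_trans zq _; rewrite ge_max u1.
have [] := @IVT R g p q y pq.
- exact: continuous_subspaceW sub gc.
- rewrite /p /q; case: (leP u v) => _.
    by rewrite ge_min uy /= le_max (ltW yv) orbT.
  by rewrite ge_min uy orbT /= le_max (ltW yv).
by move=> x xpq <-; exists x => //; exact: sub.
Qed.

End calculus.

(** * Lines through the points of the graph *)

Section envelope.
Context {R : realType}.

(** A set of diameter [d] has an image of diameter at most [C * d `^ alpha], and [N]
has covers with arbitrarily small sums of [alpha]-th powers of the diameters. *)
Lemma holder_image_null (alpha C s : R) (g : R -> R) (N : set R) :
  0 <= s -> s < alpha -> 0 < C -> N `<=` `[0, 1]%classic ->
  (forall x y, `[0, 1]%classic x -> `[0, 1]%classic y ->
    `|g x - g y| <= C * `|x - y| `^ alpha) ->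
  hausdorff_measure dist_line s N = 0%E -> outer_length (g @` N) = 0%E.
Proof.
move=> s0 sa C0 N01 gC HN; have a0 : 0 < alpha by apply: le_lt_trans sa.
apply/eqP; rewrite eq_le outer_measure_ge0 andbT.
apply/lee_addgt0Pr => e e0; rewrite add0e.
have dge0 (x y : R) : 0 <= dist_line x y by exact: normr_ge0.
have e30 : 0 < e / (3 * C) by rewrite divr_gt0 // mulr_gt0.
have [F [k [NF Fd Fe]]] := hausdorff_null_dyadic_cover dge0 s0 (ltW sa) a0 e30 HN.
pose b : R := 2 `^ (- alpha).
have b0 : 0 < b by exact: powR2N_gt0.
have sub : g @` N `<=` \bigcup_i (g @` (N `&` F i)).
  by move=> _ [x Nx <-]; have [i _ Fi] := NF _ Nx; exists i => //; exists x.
apply: le_trans (outer_length_sigma sub) _.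
(* The factor [3] leaves room for a half-open interval around a closed one. *)
have small i : (outer_length (g @` (N `&` F i)) <= (3 * C * b ^+ k i)%:E)%E.
  have [->|/set0P[x0 [Nx0 Fx0]]] := eqVneq (N `&` F i) set0.
    by rewrite image_set0 outer_measure0 lee_fin !mulr_ge0 ?exprn_ge0 // ltW.
  have l0 : 0 < C * b ^+ k i by rewrite mulr_gt0 // exprn_gt0.
  have l30 : 0 <= 3 * C * b ^+ k i by rewrite -mulrA mulr_ge0 // ltW.
  rewrite -[leRHS](outer_length_itv (g x0 - C * b ^+ k i) l30).
  apply: le_outer_measure => _ [x [Nx Fx] <-] /=.
  have : `|g x - g x0| <= C * b ^+ k i.
    apply: le_trans (gC _ _ (N01 _ Nx) (N01 _ Nx0)) _.
    rewrite ler_wpM2l ?(ltW C0) // -dyadic_powR.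
    by apply: ge0_ler_powR; rewrite ?nnegrE ?(ltW a0) ?exprn_ge0 //; exact: Fd Fx Fx0.
  by rewrite ler_norml => /andP[? ?]; apply/andP; split; lra.
apply: le_trans (lee_nneseries (v := fun i => (3 * C * b ^+ k i)%:E) _ _) _ => //.
apply: lime_le.
  by apply: is_cvg_nneseries => i _ _; rewrite lee_fin !mulr_ge0 ?exprn_ge0 // ltW.
apply: nearW => n; rewrite sumEFin lee_fin -mulr_sumr big_mkord.
by rewrite -ler_pdivlMl ?mulr_gt0 // mulrC.
Qed.

Lemma half_pow_le (alpha : R) (k : nat) : alpha <= 1 ->
  2^-1 ^+ k <= (2 `^ (- alpha)) ^+ k.
Proof.
move=> a1; rewrite lerXn2r ?nnegrE ?powR_ge0 //.
by rewrite -powR_inv1 // ler_powR ?ler1n // lerN2.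
Qed.

(** A tangent line is labelled by its own slope, because the label of a point of the
graph is the value of the derivative there. *)
Lemma tangent_separation (alpha : R) (a b : R -> R) (Y : set R) : alpha <= 1 ->
  (forall y, Y y -> a y = y) -> separated_lines (2 `^ (- alpha)) 1 a b Y.
Proof.
move=> a1 aY y y' x z k Yy Yy' _ z1; rewrite !aY // mul1r => close.
apply: (@le_trans _ _ (z * 2^-1 ^+ k)); first by apply: le_trans close; rewrite lerDl.
by rewrite ler_wpM2l ?half_pow_le //; lra.
Qed.

(** If the lines cross the graph at a definite angle, then close lines cross it at
close points, and the derivative, being Hoelder, sends close points to close labels.
The inequality between points and [f] expresses the definite angle. *)
Lemma transversal_separation (alpha C N : R) (f g phi a b : R -> R) (Y : set R) :
  0 < alpha <= 1 -> 0 < C -> 1 <= N ->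
  (forall x y, `[0, 1]%classic x -> `[0, 1]%classic y ->
    `|g x - g y| <= C * `|x - y| `^ alpha) ->
  (forall y, Y y -> [/\ `[0, 1]%classic (phi y), g (phi y) = y
    & f (phi y) = a y * phi y + b y]) ->
  (forall y y', Y y -> Y y' ->
    `|phi y' - phi y| <= N * `|f (phi y') - f (phi y) - a y * (phi y' - phi y)|) ->
  separated_lines (2 `^ (- alpha)) (C * N) a b Y.
Proof.
move=> /andP[a0 a1] C0 N1 gC Yphi trans y y' x z k Yy Yy' /andP[x0 x1] z1 close.
have [p01 gp fp] := Yphi _ Yy; have [p01' gp' fp'] := Yphi _ Yy'.
have d0 : 0 < 2^-1 ^+ k :> R by rewrite exprn_gt0.
have z0 : 0 < z by lra.
have N0 : 0 < N by lra.
have near : `|phi y' - phi y| <= N * z * 2^-1 ^+ k.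
  apply: le_trans (trans _ _ Yy Yy') _; rewrite -mulrA ler_wpM2l ?(ltW N0) //.
  apply: le_trans close; rewrite fp fp'.
  have -> : a y' * phi y' + b y' - (a y * phi y + b y) - a y * (phi y' - phi y) =
    - ((a y - a y') * (phi y' - x)) - ((a y - a y') * x + (b y - b y')) by ring.
  apply: le_trans (ler_normB _ _) _; rewrite lerD2r normrN normrM ler_piMr //.
  move: p01'; rewrite /= in_itv /= => /andP[? ?].
  by rewrite ler_norml; apply/andP; split; lra.
rewrite distrC -gp -gp'; apply: le_trans (gC _ _ p01' p01) _.
rewrite -!mulrA ler_wpM2l ?(ltW C0) // mulrA.
apply: (@le_trans _ _ ((N * z * 2^-1 ^+ k) `^ alpha)).
  by apply: ge0_ler_powR; rewrite ?nnegrE ?(ltW a0) ?mulr_ge0 // ltW.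
have Nz : 1 <= N * z by rewrite -[leLHS]mulr1 ler_pM.
rewrite powRM ?dyadic_powR ?mulr_ge0 ?(ltW d0) ?(ltW N0) ?(ltW z0) //.
by rewrite ler_wpM2r ?exprn_ge0 ?powR_ge0 // ler1_powR.
Qed.

(** A line that is not tangent leaves the graph linearly near the point where it
crosses it; a single integer can serve as radius, as angle and as bound for the
slope, which leaves countably many cases. *)
Lemma transversal_radius (f g : R -> R) (x a : R) : derivative_on01 f g ->
  `[0, 1]%classic x -> a != g x ->
  exists n : nat, `|a| <= n.+1%:R /\ forall x', `[0, 1]%classic x' ->
    `|x' - x| <= n.+1%:R^-1 ->
    `|x' - x| <= n.+1%:R * `|f x' - f x - a * (x' - x)|.
Proof.
move=> fg x01 agx; pose e := `|g x - a| / 2.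
have e0 : 0 < e by rewrite divr_gt0 // normr_gt0 subr_eq0 eq_sym.
have [d d0 hd] := derivative_on01_approx fg x01 e0.
have ei0 : 0 < e^-1 by rewrite invr_gt0.
have di0 : 0 < d^-1 by rewrite invr_gt0.
pose n := Num.trunc (`|a| + e^-1 + d^-1); exists n.
have big : `|a| + e^-1 + d^-1 < n.+1%:R.
  have /truncn_itv/andP[] // : 0 <= `|a| + e^-1 + d^-1.
  by rewrite !addr_ge0 // ltW.
have na := normr_ge0 a.
split; first lra.
move=> x' x01' near.
have {}near : `|x' - x| < d.
  apply: le_lt_trans near _; rewrite invf_plt ?posrE //; lra.
have {hd} := hd _ x01' near.
have : e * (2 * `|x' - x|) <= `|f x' - f x - g x * (x' - x)|
    + `|f x' - f x - a * (x' - x)|.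
  rewrite mulrA /e divfK // -normrM.
  have -> : (g x - a) * (x' - x) =
    (f x' - f x - a * (x' - x)) - (f x' - f x - g x * (x' - x)) by ring.
  by rewrite [leRHS]addrC; exact: ler_normB.
set A := `|f x' - f x - a * (x' - x)| => h1 h2.
have h3 : e * `|x' - x| <= A by lra.
have n0 : 0 < n.+1%:R :> R by rewrite ltr0n.
have ne : 1 <= n.+1%:R * e.
  by rewrite -[leLHS](mulVf (lt0r_neq0 e0)) ler_pM2r //; lra.
apply: (@le_trans _ _ (n.+1%:R * (e * `|x' - x|))); last by rewrite ler_pM2l.
by rewrite mulrA ler_peMl.
Qed.

(** By countable subadditivity, it is enough to treat the tangent lines, or the
lines that cross at an angle [n] within an interval of length [n.+1%:R^-1], which is
short enough for [transversal_separation] to compare any two of them. *)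
Lemma exists_separated_piece (alpha C c V0 : R) (f g phi a b : R -> R) (Y0 : set R) :
  0 < alpha <= 1 -> 0 < C -> derivative_on01 f g ->
  (forall x y, `[0, 1]%classic x -> `[0, 1]%classic y ->
    `|g x - g y| <= C * `|x - y| `^ alpha) ->
  (forall y, Y0 y -> [/\ `[0, 1]%classic (phi y), g (phi y) = y
    & f (phi y) = a y * phi y + b y]) ->
  (forall y, Y0 y -> c <= y < c + 1) ->
  0 < V0 -> (V0%:E <= outer_length Y0)%E ->
  exists Y m K V, [/\ Y `<=` Y0, 0 <= m, 0 <= K & 0 < V] /\
    [/\ (V%:E <= outer_length Y)%E, forall y, Y y -> `|a y| <= m
      & separated_lines (2 `^ (- alpha)) K a b Y].
Proof.
move=> a01 C0 fg gC Yphi Yc V00 V0Y.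
have /andP[a0 a1] := a01.
pose trans (n : nat) y := `|a y| <= n.+1%:R /\ forall x', `[0, 1]%classic x' ->
    `|x' - phi y| <= n.+1%:R^-1 ->
    `|x' - phi y| <= n.+1%:R * `|f x' - f (phi y) - a y * (x' - phi y)|.
pose T i := [set y | Y0 y /\ if i is n.+1 then trans n y else a y = y].
have YT : Y0 `<=` \bigcup_i T i.
  move=> y Yy; have [ay|ay] := eqVneq (a y) y; first by exists 0%N.
  have [p01 gp fp] := Yphi _ Yy.
  have [|n hn] := @transversal_radius f g (phi y) (a y) fg p01.
    by rewrite gp.
  by exists n.+1.
have [[|n] [V V1 VT]] := outer_length_piece V00 V0Y YT.
  exists (T 0%N), (`|c| + 1), 1, V; split; split => //.
  - by move=> y [].
  - move=> y [Yy ay]; have /andP[? ?] := Yc _ Yy; rewrite ay.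
    have := ler_norm c; have := ler_norm (- c); rewrite normrN ler_norml => ? ?.
    by apply/andP; split; lra.
  - by apply: tangent_separation => // y [].
pose P r := [set y | T n.+1 y /\ r%:R <= phi y * n.+1%:R < r.+1%:R].
have TP : T n.+1 `<=` \bigcup_r P r.
  move=> y Ty; have [/Yphi[p01 _ _] _] := Ty.
  exists (Num.trunc (phi y * n.+1%:R)) => //; split => //; apply: truncn_itv.
  by move: p01; rewrite /= in_itv /= => /andP[? _]; rewrite mulr_ge0.
have [r [W W0 WP]] := outer_length_piece V1 VT TP.
exists (P r), n.+1%:R, (C * n.+1%:R), W; split; split => //.
- by move=> y [[]].
- by rewrite mulr_ge0 // ltW.
- by move=> y [[_ []]].
apply: (@transversal_separation alpha C n.+1%:R f g phi) => //.
- by rewrite ler1n.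
- by move=> y [[/Yphi]].
move=> y y' [[Yy [_ tr]] /andP[r1 r2]] [[Yy' _] /andP[r1' r2']].
apply: tr; first by have [] := Yphi _ Yy'.
rewrite -[leRHS]mul1r ler_pdivlMr ?ltr0n //.
rewrite -[X in _ * X](ger0_norm (ler0n R n.+1)) -normrM mulrBl.
by rewrite -natr1 in r2 r2'; rewrite ler_norml; apply/andP; split; lra.
Qed.

End envelope.

(** * The dimension bound *)

Lemma coord_dist_plane (R : realType) (p q : R * R) :
  `|p.1 - q.1| <= dist_plane p q /\ `|p.2 - q.2| <= dist_plane p q.
Proof.
by split; rewrite -sqrtr_sqr /dist_plane ler_wsqrtr // ?lerDl ?lerDr sqr_ge0.
Qed.

Theorem theorem4p2 (R : realType) (alpha : R) (I : set R) (f : R -> R)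
    (Lambda : set (R * R))
    (alpha_gt0 : 0 < alpha) (alpha_le1 : alpha <= 1)
    (I_sub : I `<=` `[0, 1])
    (dim_compl : (hausdorff_dim dist_line (`[0%R, 1%R] `\` I) < alpha%:E)%E)
    (f_C1alpha : C1holder alpha f)
    (f_nonlinear : ~ linear_on01 f)
    (Lambda_borel : borel Lambda)
    (graph_sub :
      [set (x, f x) | x in I] `<=` \bigcup_(ab in Lambda) line ab) :
  ((alpha + 1)%:E
    <= hausdorff_dim dist_plane (\bigcup_(ab in Lambda) line ab))%E.
Proof.
have [g [fg gcont [C1 gC1]]] := f_C1alpha.
pose C := Num.max C1 1.
have C0 : 0 < C by rewrite lt_max ltr01 orbT.
have gC x y : `[0, 1]%classic x -> `[0, 1]%classic y ->
    `|g x - g y| <= C * `|x - y| `^ alpha.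
  move=> hx hy; apply: le_trans (gC1 _ _ hx hy) _.
  by rewrite ler_wpM2r ?powR_ge0 // le_max lexx.
have [|c [w [/andP[w0 w1] gw]]] := nonconstant_image_itv gcont.
  by move=> [k gk]; apply: f_nonlinear; exact: derivative_on01_cst gk.
(* [phi] is an arbitrary right inverse of the derivative. *)
have /choice[phi phiP] : forall y, exists x, c <= y < c + w ->
    `[0, 1]%classic x /\ g x = y.
  move=> y; have [cy|ncy] := boolP (c <= y < c + w); last by exists 0.
  by have [x ? ?] := gw _ cy; exists x.
have /choice[ab abP] : forall y, exists ab : R * R, I (phi y) ->
    Lambda ab /\ f (phi y) = ab.1 * phi y + ab.2.
  move=> y; have [Iy|nIy] := pselect (I (phi y)); last by exists (0, 0).
  by have [|ab ? ?] := graph_sub (phi y, f (phi y)); [exists (phi y) | exists ab].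
pose Y0 := [set y | c <= y < c + w /\ I (phi y)].
have wY0 : (w%:E <= outer_length Y0)%E.
  have /ereal_inf_lt[_ [s [s0 Hs] <-]] := dim_compl; rewrite lte_fin => sa.
  have null := holder_image_null s0 sa C0 (@subDsetl _ _ _) gC Hs.
  rewrite -(outer_length_itv c (ltW w0)) -[leRHS]adde0 -[X in (_ + X)%E]null.
  apply: le_trans (outer_measureU2 _ _ _); apply: le_outer_measure => y /= cy.
  have [p01 gp] := phiP _ cy.
  by have [Iy|nIy] := pselect (I (phi y)); [left | right; exists (phi y)].
pose a y := (ab y).1; pose b y := (ab y).2.
have Y0P y : Y0 y -> [/\ `[0, 1]%classic (phi y), g (phi y) = y
    & f (phi y) = a y * phi y + b y].
  by move=> [/phiP[? ?] /abP[_ ?]].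
have Y0c y : Y0 y -> c <= y < c + 1.
  by move=> [/andP[-> yw] _] /=; lra.
have a01 : 0 < alpha <= 1 by rewrite alpha_gt0.
have [Y [m [K [V [[YY0 m0 K0 V0] [VY am sep]]]]]] :=
  exists_separated_piece a01 C0 fg gC Y0P Y0c w0 wY0.
rewrite leNgt; apply/negP => /ereal_inf_lt[_ [s [s0 Hs] <-]]; rewrite lte_fin => sa.
(* A positive exponent between [s] and [alpha + 1], as [s] may vanish. *)
pose t := Num.max s 1.
have st : s <= t by rewrite le_max lexx.
have t1 : 1 <= t by rewrite le_max lexx orbT.
have ta : t < alpha + 1 by rewrite gt_max sa ltrDr.
have t0 : 0 < t by lra.
pose sigma : R := 2 `^ (- t); pose beta : R := 2 `^ (- alpha).
(* One quarter of the gain in the exponent for each factor [theta ^+ k] lost. *)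
pose eta := (alpha + 1 - t) / 4.
have eta0 : 0 < eta by rewrite divr_gt0 // subr_gt0.
pose theta : R := 2 `^ (- eta).
have theta01 : 0 < theta < 1 by rewrite powR2N_gt0 powR2N_lt1.
have betaE : beta = 2 * sigma * theta ^+ 4.
  rewrite /theta -powR_mulrn ?powR_ge0 // -powRrM -{1}(powRr1 (ler0n R 2)).
  rewrite /sigma /beta.
  rewrite -!powRD ?pnatr_eq0 ?implybT //.
  by congr (_ `^ _); rewrite /eta; field.
pose KK := 2 + K * (2 * m + 1) + K * (2 * (2 * m + 1) + 2 * m).
pose L := V * ((1 - theta) / 2) ^+ 3 * (1 - theta).
have KK0 : 0 < KK.
  rewrite !ltr_pwDl // ?mulr_ge0 // ?addr_ge0 ?mulr_ge0 //.
  by rewrite addr_ge0 // mulr_ge0.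
have L0 : 0 < L.
  by move: theta01 => /andP[? ?]; rewrite !mulr_gt0 ?exprn_gt0 ?divr_gt0 // subr_gt0.
have e0 : 0 < L / (8 * KK) by rewrite divr_gt0 // mulr_gt0.
have dge0 (p q : R * R) : 0 <= dist_plane p q by exact: sqrtr_ge0.
have [F [kf [EF Fd Fe]]] := hausdorff_null_dyadic_cover dge0 s0 st t0 e0 Hs.
have : L <= 4 * (L / (8 * KK)) * KK.
  apply: (@kakeya_bound R Y a b c m K V beta sigma theta _ F kf) => //.
  - exact: powR2N_gt0.
  - by have := @half_pow_le R alpha 1 alpha_le1; rewrite !expr1.
  - by move=> y /YY0/Y0c.
  - move=> y x /YY0[_ /abP[Lab _]] _.
    have [|i _ Fi] := EF (x, a y * x + b y); first by exists (ab y).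
    by exists i.
  move=> i p q Fp Fq; have [h1 h2] := coord_dist_plane p q.
  by have h := Fd _ _ _ Fp Fq; split; apply: le_trans h.
have -> : 4 * (L / (8 * KK)) * KK = L / 2 by field; rewrite gt_eqF.
lra.
Qed.
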